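(* There exist $M\ge2$ and a tuple $A=(A_1,\ldots,A_M)$ of matrices in $GL_2(\mathbb{R})$ with $\|A_i\|<1$ for all $i$, such that the supremum of $\dim_{\mathsf{LY}}(\nu,(A_{\mathtt{i}})_{\mathtt{i}\in\{1,\ldots,M\}^n})$, taken over all integers $n\ge1$ and all fully supported Bernoulli measures $\nu$ on $(\{1,\ldots,M\}^n)^{\mathbb{N}}$, is strictly less than $\dim_{\mathsf{AFF}}(A)$.
   Context: For a word $\mathtt{i}=(i_1,\ldots,i_n)$, $A_{\mathtt{i}}=A_{i_n}\cdots A_{i_1}$. Singular values: $\alpha_1(B)\ge\alpha_2(B)$. Set $\varphi^s(B)=\alpha_1(B)^s$ for $0\le s<1$, $\alpha_1(B)\alpha_2(B)^{s-1}$ for $1\le s<2$, $|\det B|^{s/2}$ for $s\ge2$; $P(\varphi^s,A)=\lim_{n\to\infty}\frac1n\log\sum_{(i_1,\ldots,i_n)\in\{1,\ldots,M\}^n}\varphi^s(A_{i_1}\cdots A_{i_n})$; when all $\|A_i\|<1$ (Euclidean operator norm), $\dim_{\mathsf{AFF}}(A)$ is the unique $s\ge0$ with $P(\varphi^s,A)=0$. For a finite alphabet $\Lambda$, a tuple $B=(B_a)_{a\in\Lambda}$ in $GL_2(\mathbb{R})$ and a shift-invariant Borel probability measure $\rho$ on $\Lambda^{\mathbb{N}}$, let $B(x,n)=B_{x_n}\cdots B_{x_1}$ and $\lambda_i(\rho)=\lim_{n\to\infty}\frac1n\int\log\alpha_i(B(x,n))\,d\rho(x)$ for $i=1,2$;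 $h(\rho)$ is the metric entropy of the shift. The Lyapunov dimension $\dim_{\mathsf{LY}}(\rho,B)$ is $\frac{h(\rho)}{-\lambda_1(\rho)}$ if $h(\rho)<-\lambda_1(\rho)$; $1+\frac{h(\rho)+\lambda_1(\rho)}{-\lambda_2(\rho)}$ if $-\lambda_1(\rho)\le h(\rho)<-\lambda_1(\rho)-\lambda_2(\rho)$; and $\frac{2h(\rho)}{-\lambda_1(\rho)-\lambda_2(\rho)}$ if $-\lambda_1(\rho)-\lambda_2(\rho)\le h(\rho)$. A Bernoulli measure on $\Lambda^{\mathbb{N}}$ is a product measure $p^{\mathbb{N}}$ with $p$ a probability vector on $\Lambda$; it is fully supported if all entries of $p$ are positive. Identifying $(\{1,\ldots,M\}^n)^{\mathbb{N}}$ with $\{1,\ldots,M\}^{\mathbb{N}}$, these are the fully supported $\sigma^n$-invariant Bernoulli measures defined on $n$-cylinders, $\sigma$ being the left shift. *)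

(* Defs.v *)
From HB Require Import structures.
From mathcomp Require Import all_boot all_order all_algebra.
From mathcomp Require Import all_classical all_reals all_analysis.

Set Implicit Arguments.
Unset Strict Implicit.
Unset Printing Implicit Defensive.

Import Order.TTheory GRing.Theory Num.Theory.
Import numFieldNormedType.Exports.

Local Open Scope classical_set_scope.
Local Open Scope ring_scope.

(* Matrices act on column vectors. *)
Definition euclidean_norm (R : realType) (d : nat) (v : 'cV[R]_d) : R :=
  Num.sqrt (\sum_i v i ord0 ^+ 2).

Definition operator_norm (R : realType) (d : nat) (B : 'M[R]_d) : R :=
  sup [set euclidean_norm (B *m v) | v in [set v | euclidean_norm v = 1]].

(* In dimension two the singular values, counted with multiplicity, are the
   square roots of the largest and of the smallest eigenvalue of B^T B. *)
Definition singular_max (R : realType) (B : 'M[R]_2) : R :=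
  Num.sqrt (sup [set a | eigenvalue (B^T *m B) a]).

Definition singular_min (R : realType) (B : 'M[R]_2) : R :=
  Num.sqrt (inf [set a | eigenvalue (B^T *m B) a]).

Definition singular_value_function (R : realType) (s : R) (B : 'M[R]_2) : R :=
  if s < 1 then singular_max B `^ s
  else if s < 2 then singular_max B * singular_min B `^ (s - 1)
  else `|\det B| `^ (s / 2).

(* The factors appear in the order of the word: A_{i_1} ... A_{i_n}. *)
Definition pressure (R : realType) (L : finType) (s : R) (A : L -> 'M[R]_2) : R :=
  limn (fun n : nat => n%:R^-1 *
    ln (\sum_(w : n.-tuple L) singular_value_function s (\prod_(i <- w) A i))).

(* For invertible matrices of operator norm less than 1 there is exactly one
   such s; [get] returns an arbitrary value when there is none. *)
Definition affinity_dimension (R : realType) (L : finType) (A : L -> 'M[R]_2) : R :=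
  get [set s : R | 0 <= s /\ pressure s A = 0].

(* The factors appear in the reverse order: A_{i_n} ... A_{i_1}. *)
Definition word_matrix (R : realType) (L : Type) (A : L -> 'M[R]_2) (w : seq L) :
    'M[R]_2 :=
  \prod_(i <- rev w) A i.

(* Measurable types are pointed in the library, hence so are alphabets. *)
#[short(type="alphabetType")]
HB.structure Definition Alphabet := {L of Finite L & Pointed L}.

HB.instance Definition _ (m : nat) := isPointed.Build 'I_m.+1 ord0.
HB.saturate tuple_of.

(* One-sided sequences with the product sigma-algebra, which is also the Borel
   sigma-algebra since L is finite and discrete.  Sequences are indexed from 0,
   so that x_1 is [x 0]. *)
Definition coordinate_cylinders (L : alphabetType) : set (set (nat -> L)) :=
  [set C | exists k a, C = [set x | x k = a]].

Notation seq_space L := (g_sigma_algebraType (@coordinate_cylinders L)).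

Definition shift (L : Type) (x : nat -> L) : nat -> L := fun k => x k.+1.

Definition cylinder (L : Type) (w : seq L) : set (nat -> L) :=
  [set x | mkseq x (size w) = w].

(* A finite measurable partition is encoded as a measurable labelling f of the
   points by 'I_k (some labels may be unused: their contribution is 0 * ln 0 = 0);
   the atoms of the join of T^{-i}(f), i < n, are the sets of points sharing an
   itinerary of length n. *)
Definition join_entropy d (X : measurableType d) (R : realType)
    (mu : probability X R) (T : X -> X) (k : nat) (f : X -> 'I_k) (n : nat) : R :=
  \sum_(w : n.-tuple 'I_k)
    let p := fine (mu [set x | forall i : 'I_n, f (iter i T x) = tnth w i]) in
    - (p * ln p).

Definition partition_entropy d (X : measurableType d) (R : realType)
    (mu : probability X R) (T : X -> X) (k : nat) (f : X -> 'I_k) : R :=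
  limn (fun n : nat => n%:R^-1 * join_entropy mu T f n).

Definition metric_entropy d (X : measurableType d) (R : realType)
    (mu : probability X R) (T : X -> X) : \bar R :=
  ereal_sup [set e | exists (k : nat) (f : X -> 'I_k),
    (forall j : 'I_k, measurable (f @^-1` [set j])) /\
    e = (partition_entropy mu T f)%:E].

(* [alpha] is one of the two singular values, and
   word_matrix B (mkseq x n) = B_{x_n} ... B_{x_1}. *)
Definition lyapunov_exponent (R : realType) (L : alphabetType)
    (alpha : 'M[R]_2 -> R) (rho : probability (seq_space L) R)
    (B : L -> 'M[R]_2) : R :=
  limn (fun n : nat => n%:R^-1 *
    \int[rho]_x ln (alpha (word_matrix B (mkseq x n)))).

(* For a shift-invariant rho the entropy is at most ln #|L|, so [fine] loses
   nothing. *)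
Definition lyapunov_dimension (R : realType) (L : alphabetType)
    (rho : probability (seq_space L) R) (B : L -> 'M[R]_2) : R :=
  let h := fine (metric_entropy rho (@shift L)) in
  let l1 := lyapunov_exponent (@singular_max R) rho B in
  let l2 := lyapunov_exponent (@singular_min R) rho B in
  if h < - l1 then h / - l1
  else if h < - l1 - l2 then 1 + (h + l1) / - l2
  else 2 * h / (- l1 - l2).

(* The values on cylinders characterize the product measure p^N. *)
Definition is_bernoulli (R : realType) (L : alphabetType) (p : L -> R)
    (rho : probability (seq_space L) R) : Prop :=
  [/\ forall a, 0 <= p a, \sum_a p a = 1 &
      forall w : seq L, rho (cylinder w) = (\prod_(a <- w) p a)%:E].

Definition fully_supported_bernoulli (R : realType) (L : alphabetType)
    (rho : probability (seq_space L) R) : Prop :=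
  exists2 p : L -> R, is_bernoulli p rho & forall a, 0 < p a.

(* Main.v *)
Require Import Defs.
From HB Require Import structures.
From mathcomp Require Import all_boot all_order all_algebra.
From mathcomp Require Import all_classical all_reals all_analysis.
From mathcomp Require Import ring lra.


(** The tuple consists of A_0 = diag(4/5, 1/5) and of A_1, which is 2/5 times the
swap of the two coordinate axes; both determinants have absolute value (2/5)^2.
A product of n of these matrices is (2/5)^n times a monomial matrix with entries
e^S and e^(-S), where S performs a signed walk: a factor A_0 adds ln 2 to S, and
a factor A_1 replaces S by -S.  The singular values are (2/5)^n e^|S| and
(2/5)^n e^(-|S|).

A fully supported Bernoulli measure on blocks of length n charges blocks with an
even and blocks with an odd number of swaps.  The direction of the walk is
therefore forgotten exponentially fast, the mean of S^2 after N blocks is O(N)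
and the mean of |S| is o(N) ([mean_abs_walk_sublinear]).  Both Lyapunov exponents
are thus equal to n ln(2/5), and for equal exponents the Lyapunov dimension is
the quotient of the entropy by -n ln(2/5), whichever of the three cases of its
definition applies.  Since the entropy of the shift is at most n ln 2
([metric_entropy_le]), the dimension is at most ln 2 / ln(5/2) < 1, uniformly in
n and in the measure.

In the pressure, for s > 0, words for which |S| is of order n dominate.  For
0 <= s <= 1 the sum of e^(s|S|) over all words of length n is comparable to the sum of
2 cosh(s(S + (ln 2)/2)), and the latter function is an eigenfunction of the
operator that sums over the two choices of a further factor ([walk_eigen]).
This gives the exact value P(s) = ln((4/5)^s + (1/5)^s), which is positive for
s < 1 and vanishes for s = 1, so that the affinity dimension is at least 1
([affinity_dimension_example_mx_ge1]).

The entropy bound concerns arbitrary finite measurable partitions.  A labelling f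
of the points agrees, outside a set of small measure, with a labelling g that
depends on N coordinates only ([approximable_fun]).  An itinerary of length n
under f is then described by n + N letters of the sequence together with the few
places where f and g disagree; comparing the distribution of itineraries with
the weights of this description by Gibbs' inequality bounds the entropy
([join_entropy_le]). *)

Set Implicit Arguments.
Unset Strict Implicit.
Unset Printing Implicit Defensive.

Import Order.TTheory GRing.Theory Num.Theory.
Import numFieldNormedType.Exports.

Local Open Scope classical_set_scope.
Local Open Scope ring_scope.

(** * Monomial matrices of order two *)

(** Row i carries c e^S for i = 0 and c e^(-S) for i = 1, on the diagonal or, when e
holds, on the antidiagonal.  As the two exponents are opposite, a product of such
matrices multiplies the factors c and adds the exponents S up to sign. *)
Definition monomial_mx (R : realType) (e : bool) (c S : R) : 'M[R]_2 :=
  \matrix_(i, j) ((j == if e then rev_ord i else i)%:R * (c * expR ((-1) ^+ i * S))).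

Lemma ord2P (i : 'I_2) : i = 0 \/ i = 1.
Proof. by case: i => [[|[|//]] ?]; [left|right]; apply/val_inj. Qed.

Lemma monomial_mxM (R : realType) e e' (c c' S S' : R) :
  monomial_mx e c S *m monomial_mx e' c' S' = monomial_mx (e (+) e') (c * c') (S + (-1) ^+ e * S').
Proof.
apply/matrixP => i j; rewrite !mxE !big_ord_recl big_ord0 !mxE /=.
have /= [->|->] := ord2P i; have /= [->|->] := ord2P j;
 case: e; case: e' => //=;
 rewrite -?val_eqE/= /bump /= ?expr0 ?expr1 ?mul1r ?mul0r ?mulN1r ?addr0 ?add0r ?opprD ?opprK
   ?expRD ?mulr0 ?mul0r; try ring.
Qed.

Lemma monomial_mx1 (R : realType) : monomial_mx false (1 : R) 0 = 1.
Proof. by apply/matrixP => i j; rewrite !mxE mulr0 expR0 !mulr1 eq_sym. Qed.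

(** The hypothesis is an equation on an arbitrary matrix because D will be a product
B^T B that is only provably diagonal. *)
Lemma eigenvalues_diag2 (R : realType) (a b : R) (D : 'M[R]_2) :
  D = \matrix_(i, j) ((j == i)%:R * (if i == 0 then a else b)) ->
  [set l | eigenvalue D l] = [set a; b].
Proof.
move=> HD; apply/seteqP; split => l /=.
- move=> /eigenvalueP [v /rowP hv v0].
  case/rV0Pn : v0 => i vi.
  move: (hv i); rewrite mxE big_ord_recl big_ord_recl big_ord0 HD !mxE /=.
  have /= [ei|ei] := ord2P i; rewrite ei -?val_eqE /= in vi *;
  rewrite ?(mul1r, mulr0, mul0r, addr0, add0r).
  + have -> : (ord0 : 'I_2) = 0 by [].
    by rewrite mulrC => /(mulIf vi) ->; left.
  + have -> : lift ord0 ord0 = 1 :> 'I_2 by exact: val_inj.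
    by rewrite mulrC => /(mulIf vi) <-; right.
- case=> ->; apply/eigenvalueP.
  + exists (delta_mx 0 0).
      apply/rowP => j; rewrite !mxE big_ord_recl big_ord_recl big_ord0 HD !mxE.
      have /= [->|->] := ord2P j; rewrite -?val_eqE /=; ring.
    apply/eqP => /rowP /(_ 0); rewrite !mxE /= => /eqP; by rewrite oner_eq0.
  + exists (delta_mx 0 1).
      apply/rowP => j; rewrite !mxE big_ord_recl big_ord_recl big_ord0 HD !mxE.
      have /= [->|->] := ord2P j; rewrite -?val_eqE /=; ring.
    apply/eqP => /rowP /(_ 1); rewrite !mxE /= => /eqP; by rewrite oner_eq0.
Qed.

(** B^T B is diagonal with entries c^2 e^(2S) and c^2 e^(-2S) in an order that depends
on e; writing the pair with |S| removes the dependence. *)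
Lemma eigenvalues_monomial_mx (R : realType) e (c S : R) :
  [set l | eigenvalue ((monomial_mx e c S)^T *m monomial_mx e c S) l] =
  [set (c * expR `|S|) ^+ 2; (c * expR (- `|S|)) ^+ 2].
Proof.
have H : [set l | eigenvalue ((monomial_mx e c S)^T *m monomial_mx e c S) l] =
  [set (c * expR ((-1) ^+ e * S)) ^+ 2; (c * expR (- ((-1) ^+ e * S))) ^+ 2].
  apply: eigenvalues_diag2; apply/matrixP => i j; rewrite !mxE !big_ord_recl big_ord0 !mxE /=.
  have /= [->|->] := ord2P i; have /= [->|->] := ord2P j; case: e => //=;
  rewrite -?val_eqE/= /bump /= ?expr0 ?expr1 ?mul1r ?mul0r ?mulN1r ?opprK
    ?addr0 ?add0r ?mulr0 ?mul0r; try ring.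
rewrite H; case: e {H} => /=; rewrite ?expr1 ?expr0 ?mulN1r ?mul1r ?opprK;
 case: (ger0P S) => S0; rewrite ?opprK //; by rewrite setUC.
Qed.

Lemma monomial_mx_eigenvalues_le (R : realType) (c S : R) : 0 < c ->
  (c * expR (- `|S|)) ^+ 2 <= (c * expR `|S|) ^+ 2.
Proof.
move=> c0; rewrite ler_sqr ?nnegrE ?mulr_ge0 ?expR_ge0 ?(ltW c0) //.
by rewrite ler_pM2l // ler_expR (le_trans (_ : _ <= 0)) ?oppr_le0.
Qed.

Lemma singular_max_monomial_mx (R : realType) e (c S : R) : 0 < c ->
  singular_max (monomial_mx e c S) = c * expR `|S|.
Proof.
move=> c0; rewrite /singular_max eigenvalues_monomial_mx setUC sup_setU ?sup1.
- by rewrite sqrtr_sqr ger0_norm ?mulr_ge0 ?ltW ?expR_gt0.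
- by split; [exists ((c * expR `|S|) ^+ 2) | exists ((c * expR `|S|) ^+ 2) => x ->].
- by move=> x y -> ->; exact: monomial_mx_eigenvalues_le.
Qed.

Lemma singular_min_monomial_mx (R : realType) e (c S : R) : 0 < c ->
  singular_min (monomial_mx e c S) = c * expR (- `|S|).
Proof.
move=> c0; rewrite /singular_min eigenvalues_monomial_mx setUC inf_setU ?inf1.
- by rewrite sqrtr_sqr ger0_norm ?mulr_ge0 ?ltW ?expR_gt0.
- by split; [exists ((c * expR (-`|S|)) ^+ 2) | exists ((c * expR (-`|S|)) ^+ 2) => x ->].
- by move=> x y -> ->; exact: monomial_mx_eigenvalues_le.
Qed.

Section Walk.
Variables (R : realType) (L : Type) (e : L -> bool) (S : L -> R).

(** The two coordinates of a product in the semidirect product of R by the group of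
signs: the sign here, the translation below. *)
Definition word_parity (w : seq L) := \big[addb/false]_(i <- w) e i.
Fixpoint word_walk (w : seq L) : R :=
  if w is a :: w' then S a + (-1) ^+ e a * word_walk w' else 0.

Lemma monomial_mx_prod c (w : seq L) :
  \prod_(i <- w) monomial_mx (e i) c (S i) = monomial_mx (word_parity w) (c ^+ size w) (word_walk w).
Proof.
rewrite /word_parity; elim: w => [|a w IH].
  by rewrite !big_nil /= expr0 monomial_mx1.
by rewrite !big_cons IH -mulmxE monomial_mxM exprS.
Qed.
Lemma word_parity_rev (w : seq L) : word_parity (rev w) = word_parity w.
Proof.
rewrite /word_parity; elim: w => // a w IH.
by rewrite rev_cons -cats1 big_cat big_seq1 /= IH big_cons addbC.
Qed.
End Walk.

(** * Sums over words and exponential growth rates *)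

(** Splitting off the first letter is the induction step of all sums over words below. *)
Lemma big_tupleS (V : nmodType) (L : finType) n (F : seq L -> V) :
  \sum_(w : n.+1.-tuple L) F w = \sum_a \sum_(w : n.-tuple L) F (a :: w).
Proof.
rewrite pair_big /=.
rewrite (reindex (fun p : L * n.-tuple L => cons_tuple p.1 p.2)) //=.
exists (fun w : n.+1.-tuple L => (thead w, behead_tuple w)) => [[a w] _|w _] /=.
  by congr pair; apply/val_inj.
by rewrite [RHS]tuple_eta; apply/val_inj.
Qed.

Lemma big_tuple0 (V : nmodType) (L : finType) (F : seq L -> V) :
  \sum_(w : 0.-tuple L) F w = F [::].
Proof.
rewrite (big_pred1 [tuple]) => [|w]; rewrite ?tuple0 //=.
by apply/esym/eqP; exact: tuple0.
Qed.

Lemma cvg_invn (R : realType) (a : R) : n%:R^-1 * a @[n --> \oo] --> 0.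
Proof.
rewrite -[X in _ --> X](mul0r a); apply: cvgMr_tmp.
by rewrite -(cvg_shiftS (fun n : nat => n%:R^-1 : R)); exact: cvg_harmonic.
Qed.

(** Multiplicative constants disappear in the exponential growth rate. *)
Lemma growth_rate (R : realType) (C1 C2 l : R) (Z : nat -> R) :
  0 < C1 -> 0 < C2 -> 0 < l -> (forall n, C1 * l ^+ n <= Z n <= C2 * l ^+ n) ->
  n%:R^-1 * ln (Z n) @[n --> \oo] --> ln l.
Proof.
move=> C10 C20 l0 HZ.
have H C : n%:R^-1 * ln C + ln l @[n --> \oo] --> ln l.
  rewrite -[X in _ --> X]add0r; apply: cvgD; [exact: cvg_invn|exact: cvg_cst].
apply: (squeeze_cvgr _ (H C1) (H C2)).
near=> n.
have n0 : (0 < n)%N by near: n; exact: nbhs_infty_gt.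
have nR : 0 < n%:R^-1 :> R by rewrite invr_gt0 ltr0n.
have E C : 0 < C -> n%:R^-1 * ln C + ln l = n%:R^-1 * ln (C * l ^+ n).
  move=> C0; rewrite lnM ?posrE ?exprn_gt0 // lnXn // mulrDr.
  rewrite -(mulr_natl (ln l)) mulrA mulVf ?mul1r //.
  by rewrite pnatr_eq0 -lt0n.
have /andP[H1 H2] := HZ n.
have Z0 : 0 < Z n by apply: lt_le_trans H1; rewrite mulr_gt0 ?exprn_gt0.
rewrite !E // !ler_pM2l // !ler_ln ?posrE ?mulr_gt0 ?exprn_gt0 //.
Unshelve. all: by end_near. Qed.

(** * The example and its affinity dimension *)

(** Index 0 is diag(4/5, 1/5), since (2/5) e^(ln 2) = 4/5 and (2/5) e^(-ln 2) = 1/5. *)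
Definition example_mx (R : realType) (i : 'I_2) : 'M[R]_2 :=
  monomial_mx (i == 1) (2 / 5) (if i == 1 then 0 else ln 2).

Lemma example_mx_unit (R : realType) (i : 'I_2) : example_mx R i \in unitmx.
Proof.
have H : example_mx R i *m
  monomial_mx (i == 1) (5 / 2) (- ((-1) ^+ (i == 1) * (if i == 1 then 0 else ln 2))) = 1.
  rewrite monomial_mxM addbb -monomial_mx1; congr monomial_mx; first by field.
  by case: eqP => _; rewrite ?expr0 ?expr1; ring.
by case: (mulmx1_unit H).
Qed.

Lemma operator_norm_example_mx (R : realType) (i : 'I_2) : operator_norm (example_mx R i) < 1.
Proof.
(* 4/5 is the larger singular value of the first matrix. *)
apply: (@le_lt_trans _ _ (4 / 5)); last by lra.
apply: ge_sup.
  exists (euclidean_norm (example_mx R i *m (delta_mx 0 0))).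
  exists (delta_mx 0 0) => //=.
  rewrite /euclidean_norm !big_ord_recl big_ord0 !mxE -?val_eqE /= expr0n /= !addr0.
  by rewrite expr1n sqrtr1.
move=> x [v /= nv <-].
have {}nv : v 0 0 ^+ 2 + v 1 0 ^+ 2 = 1.
  move: nv; rewrite /euclidean_norm !big_ord_recl big_ord0 addr0 => /(congr1 (fun x => x ^+ 2)).
  rewrite sqr_sqrtr ?addr_ge0 ?sqr_ge0 // expr1n.
  suff -> : lift ord0 ord0 = 1 :> 'I_2 by [].
  exact: val_inj.
rewrite /euclidean_norm -[leRHS]ger0_norm -?sqrtr_sqr; last lra.
rewrite ler_sqrt ?sqr_ge0 //.
rewrite !big_ord_recl big_ord0 addr0 !mxE !big_ord_recl !big_ord0 !mxE /=.
have -> : lift ord0 ord0 = 1 :> 'I_2 by exact: val_inj.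
have -> : (ord0 : 'I_2) = 0 by [].
have /= [->|->] := ord2P i; rewrite -?val_eqE /=
  ?expr0 ?expr1 ?mulN1r ?mul1r ?oppr0 ?expRN ?lnK ?posrE ?expR0 //=.
  rewrite /bump /=.
  by have := sqr_ge0 (v 1 0); rewrite ?(mul0r,mul1r,addr0,add0r); nra.
by have := sqr_ge0 (v 1 0); rewrite ?(mul0r,mul1r,addr0,add0r); nra.
Qed.

Section Pressure.
Variables (R : realType).
Let tau : R := ln 2.
Let sw : seq 'I_2 -> R :=
  word_walk (fun i : 'I_2 => i == 1) (fun i : 'I_2 => if i == 1 then 0 else tau).

Lemma example_mx_prod (w : seq 'I_2) :
  \prod_(i <- w) example_mx R i =
  monomial_mx (word_parity (fun i : 'I_2 => i == 1) w) ((2/5) ^+ size w) (sw w).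
Proof. exact: monomial_mx_prod. Qed.

Variable s : R.
Hypothesis s0 : 0 <= s <= 1.
Let F (S : R) := expR (s * (S + tau / 2)) + expR (- (s * (S + tau / 2))).
Let Lam := expR (s * tau) + expR (- (s * tau)).

(** F S = 2 cosh(s(S + tau/2)).  Adding a factor sends S to tau + S or to -S, and the
shift by tau/2 makes the two resulting terms recombine: with t = s(S + tau/2) the
arguments are t + s tau and, up to sign, t - s tau. *)
Lemma walk_eigen S : F (tau + S) + F (- S) = Lam * F S.
Proof.
rewrite /F /Lam mulrDl !(mulrDr (expR _)) -!expRD.
have -> : s * (tau + S + tau / 2) = s * tau + s * (S + tau / 2) by ring.
have -> : s * (- S + tau / 2) = s * tau - s * (S + tau / 2) by field.
have -> : - (s * tau + s * (S + tau / 2)) = - (s * tau) - s * (S + tau / 2) by ring.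
have -> : - (s * tau - s * (S + tau / 2)) = - (s * tau) + s * (S + tau / 2) by ring.
ring.
Qed.

Lemma walk_sum n : \sum_(w : n.-tuple 'I_2) F (sw w) = Lam ^+ n * F 0.
Proof.
elim: n => [|n IH]; first by rewrite (big_tuple0 (fun w => F (sw w))) mul1r.
rewrite (big_tupleS n (fun w => F (sw w))) !big_ord_recl big_ord0 addr0 -big_split /=.
rewrite (exprS Lam) -[RHS]mulrA -IH mulr_sumr; apply: eq_bigr => w _.
by rewrite /sw -walk_eigen /= expr0 expr1 mul1r mulN1r add0r.
Qed.

(** At s = 1 the factor of the smaller singular value has exponent 0, so one formula
covers the closed interval. *)
Lemma singular_value_function_monomial_mx e c S : 0 < c ->
  singular_value_function s (monomial_mx e c S) = c `^ s * expR (s * `|S|).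
Proof.
move=> c0; rewrite /singular_value_function singular_max_monomial_mx // singular_min_monomial_mx //.
case: ltP => s1.
  by rewrite powRM ?expR_ge0 ?(ltW c0) // -expRM mulrC [_ * s]mulrC mulrC.
have -> : s = 1 by case/andP: s0 => *; lra.
by rewrite ifT ?subrr ?powRr0 ?mulr1 ?mul1r ?powRr1 ?(ltW c0) //; lra.
Qed.

(** e^(s|S|) lies between F S / (2 e^(s tau/2)) and F S e^(s tau/2), so the eigenfunction
determines the growth rate. *)
Lemma pressure_example_mx : pressure s (example_mx R) = ln ((2 / 5) `^ s * Lam).
Proof.
have tau0 : 0 <= tau by rewrite ln_ge0 //; lra.
have [s0' s1'] := andP s0.
have st0 : 0 <= s * tau by rewrite mulr_ge0.
apply: cvg_lim => //.
pose c := expR (s * (tau / 2)).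
have c0 : 0 < c by exact: expR_gt0.
have F0 S : 0 < F S by rewrite addr_gt0 ?expR_gt0.
have Lam0 : 0 < Lam by rewrite addr_gt0 ?expR_gt0.
apply: (@growth_rate R (F 0 / (2 * c)) (F 0 * c)).
- by rewrite divr_gt0 // mulr_gt0.
- by rewrite mulr_gt0.
- by rewrite mulr_gt0 // powR_gt0; lra.
move=> n.
have -> : \sum_(w : n.-tuple 'I_2) singular_value_function s (\prod_(i <- w) example_mx R i)
   = ((2/5) `^ s) ^+ n * \sum_(w : n.-tuple 'I_2) expR (s * `|sw w|).
  rewrite mulr_sumr; apply: eq_bigr => w _.
  rewrite example_mx_prod size_tuple singular_value_function_monomial_mx ?exprn_gt0 ?divr_gt0 //.
  congr (_ * _).
  by rewrite -powR_mulrn ?divr_ge0 // -powR_mulrn ?powR_ge0 // -!powRrM [_ * s]mulrC.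
have p0 : 0 <= ((2/5 : R) `^ s) ^+ n by rewrite exprn_ge0 // powR_ge0.
rewrite exprMn [F 0 / _ * _]mulrCA [F 0 * _ * _]mulrCA !ler_wpM2l //.
  rewrite [leRHS](_ : _ = (Lam ^+ n * F 0) * c); last ring.
  rewrite -walk_sum mulr_suml; apply: ler_sum => w _.
  rewrite /F mulrDl -!expRD; case: (ger0P (sw w)) => S0.
  - apply: (@le_trans _ _ (expR (s * (sw w + tau / 2) + s * (tau / 2)))).
      by rewrite ler_expR; lra.
    by rewrite lerDl expR_ge0.
  - apply: (@le_trans _ _ (expR (- (s * (sw w + tau / 2)) + s * (tau / 2)))).
      by rewrite ler_expR; lra.
    by rewrite lerDr expR_ge0.
rewrite [leLHS](_ : _ = (Lam ^+ n * F 0) / (2 * c)); last ring.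
rewrite ler_pdivrMr ?mulr_gt0 // -walk_sum mulr_suml; apply: ler_sum => w _.
rewrite /F mulrCA -expRD mulr_natl [leRHS]mulr2n.
have H : s * - `|sw w| <= s * sw w <= s * `|sw w|.
  by rewrite !ler_wpM2l ?ler_norm // lerNl -normrN ler_norm.
by have [H1 H2] := andP H; apply: lerD; rewrite ler_expR; lra.
Qed.
End Pressure.

(** The pressure vanishes at s = 1, as (2/5)(2 + 1/2) = 1, so the chosen zero really is a
zero.  For s < 1 the pressure is ln((4/5)^s + (1/5)^s) > ln(4/5 + 1/5) = 0, hence every
zero is at least 1. *)
Lemma affinity_dimension_example_mx_ge1 (R : realType) : 1 <= affinity_dimension (example_mx R).
Proof.
have tau2 (s : R) : (2 / 5) `^ s = expR (s * ln (2 / 5)) by rewrite /powR ifF //; apply/eqP; lra.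
have [] : [set s : R | 0 <= s /\ pressure s (example_mx R) = 0] (affinity_dimension (example_mx R)).
  apply: getPex; exists 1; split=> //.
  rewrite pressure_example_mx ?ler01 ?lexx // tau2 !mul1r expRN !lnK ?posrE //.
  by rewrite (_ : _ * _ = 1) ?ln1 //; field.
move: (affinity_dimension _) => s s0 Ps; rewrite leNgt; apply/negP => s1.
move: Ps; rewrite pressure_example_mx ?s0 ?ltW // tau2 mulrDr -!expRD -mulrN -!mulrDr.
rewrite -lnM ?posrE //.
rewrite -lnV ?posrE // -lnM ?posrE ?invr_gt0 //.
set a := 2 / 5 * 2; set b := _ / 2.
have H (x : R) : 0 < x -> x < 1 -> x < expR (s * ln x).
  move=> x0 x1; rewrite -[ltLHS]lnK ?posrE // ltr_expR.
  have : ln x < 0 by rewrite ln_lt0 // x0 x1.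
  nra.
have Ha : a < expR (s * ln a) by apply: H; rewrite /a; lra.
have Hb : b < expR (s * ln b) by apply: H; rewrite /b; lra.
apply/eqP; rewrite gt_eqF // ln_gt0 //.
move: Ha Hb; rewrite {1}/a {1}/b; lra.
Qed.

(** * Functions with finitely many values on a probability space *)

Lemma measurable_fin_preimage d (T : measurableType d) (I : finType) (h : T -> I) (Q : pred I) :
  (forall i, measurable (h @^-1` [set i])) -> measurable [set x | Q (h x)].
Proof.
move=> mh; have -> : [set x | Q (h x)] = \bigcup_(i in [set i | Q i]) h @^-1` [set i].
  apply/seteqP; split => x /=; first by move=> Qx; exists (h x).
  by move=> [i /= Qi ->].
by apply: fin_bigcup_measurable.
Qed.

Lemma measurable_pair_fiber d (T : measurableType d) (I J : finType) (f : T -> I) (g : T -> J) :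
  (forall i, measurable (f @^-1` [set i])) -> (forall j, measurable (g @^-1` [set j])) ->
  forall u, measurable ((fun x => (f x, g x)) @^-1` [set u]).
Proof.
move=> mf mg [i j].
rewrite (_ : _ @^-1` _ = (f @^-1` [set i]) `&` (g @^-1` [set j])); first exact: measurableI.
by apply/seteqP; split => x /= [-> ->].
Qed.

(** A function that factors through a finite type is simple. *)
Lemma Rintegral_fin d (T : measurableType d) (R : realType) (mu : probability T R)
  (I : finType) (h : T -> I) (F : I -> R) :
  (forall i, measurable (h @^-1` [set i])) ->
  \int[mu]_x F (h x) = \sum_i F i * fine (mu (h @^-1` [set i])).
Proof.
move=> mh; rewrite /Rintegral.
have E x : (F (h x))%:E = (\sum_i (F i)%:E * (\1_(h @^-1` [set i]) x)%:E)%E.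
  rewrite (bigD1 (h x)) //= indicE mem_set //= mule1 big1 ?adde0 // => i ih.
  rewrite indicE memNset ?mule0 //= => /esym /eqP; exact/negP.
under eq_integral do rewrite E.
have int1 i : mu.-integrable setT (fun x => (\1_(h @^-1` [set i]) x : R)%:E).
  exact: integrable_indic.
rewrite integral_sum //=; last by move=> i; apply: integrableZl.
rewrite [X in fine X](_ : _ = (\sum_i F i * fine (mu (h @^-1` [set i])))%:E) //.
rewrite -sumEFin; apply: eq_bigr => i _.
rewrite integralZl // integral_indic // setIT EFinM fineK //.
exact: fin_num_measure.
Qed.

Lemma fine_measure_fin_preimage d (T : measurableType d) (R : realType)
  (mu : probability T R) (I : finType) (h : T -> I) (Q : pred I) :
  (forall i, measurable (h @^-1` [set i])) ->
  fine (mu [set x | Q (h x)]) = \sum_i (Q i)%:R * fine (mu (h @^-1` [set i])).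
Proof.
move=> mh; rewrite -(Rintegral_fin mu (fun i => (Q i)%:R) mh).
rewrite (Rintegral_fin mu (fun b : bool => b%:R) (h := fun x => Q (h x))).
  by rewrite big_bool /= mul1r mul0r addr0.
move=> b; rewrite (_ : _ @^-1` _ = [set x | Q (h x) == b]).
  exact: (measurable_fin_preimage (fun i => Q i == b) mh).
by apply/seteqP; split => x /= => /eqP.
Qed.

(** * Bernoulli averages and the signed random walk *)

Section Bern.
Variables (R : realType) (L : alphabetType).

Lemma measurable_coord k (a : L) : measurable ([set x : seq_space L | x k = a]).
Proof. by apply: sub_sigma_algebra; exists k, a. Qed.

Lemma measurable_cylinder (w : seq L) : measurable (cylinder w : set (seq_space L)).
Proof.
have -> : cylinder w = \bigcap_(i in `I_(size w)) [set x : seq_space L | x i = nth point w i].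
  apply/seteqP; split => x /=.
    by move=> <- i /=; rewrite size_mkseq => iw; rewrite nth_mkseq.
  move=> H; apply: (@eq_from_nth _ point); rewrite size_mkseq // => i iw.
  by rewrite nth_mkseq //; exact: H.
by apply: bigcap_measurableType => k _; exact: measurable_coord.
Qed.

Definition prefix_tuple N (x : nat -> L) : N.-tuple L :=
  Tuple (introT eqP (size_mkseq x N)).

Lemma prefix_tuple_fiber N (w : N.-tuple L) :
  (prefix_tuple N : seq_space L -> _) @^-1` [set w] = cylinder w.
Proof.
apply/seteqP; split => x /=; rewrite /cylinder /= size_tuple.
  by move=> <-.
by move=> H; apply/val_inj.
Qed.

Lemma measurable_prefix_tuple N (w : N.-tuple L) :
  measurable ((prefix_tuple N : seq_space L -> _) @^-1` [set w]).
Proof. by rewrite prefix_tuple_fiber; exact: measurable_cylinder. Qed.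

Lemma bernoulli_integral (p : L -> R) (rho : probability (seq_space L) R) N
  (F : seq L -> R) : is_bernoulli p rho ->
  \int[rho]_x F (mkseq x N) = \sum_(w : N.-tuple L) \prod_(a <- w) p a * F w.
Proof.
case=> _ _ H.
rewrite (Rintegral_fin rho (fun w : N.-tuple L => F w) (@measurable_prefix_tuple N)).
by apply: eq_bigr => w _; rewrite prefix_tuple_fiber H /= mulrC.
Qed.
End Bern.

Section RandomWalk.
Variables (R : realType) (L : finType) (p : L -> R) (e : L -> bool) (S : L -> R).
Hypotheses (p0 : forall a, 0 <= p a) (p1 : \sum_a p a = 1).

(** The expectation, under independent letters of law p, of a function of the word
formed by n letters. *)
Definition mean n (F : seq L -> R) : R :=
  \sum_(w : n.-tuple L) \prod_(a <- w) p a * F w.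

Lemma meanS n F : mean n.+1 F = \sum_a p a * mean n (fun w => F (a :: w)).
Proof.
rewrite /mean (big_tupleS n (fun w => \prod_(a <- w) p a * F w)).
by apply: eq_bigr => a _; rewrite mulr_sumr; apply: eq_bigr => w _; rewrite big_cons mulrA.
Qed.

Lemma mean0 F : mean 0 F = F [::].
Proof. by rewrite /mean (big_tuple0 (fun w => \prod_(a <- w) p a * F w)) big_nil mul1r. Qed.

Lemma meanD n F G : mean n (fun w => F w + G w) = mean n F + mean n G.
Proof. by rewrite /mean -big_split; apply: eq_bigr => w _; rewrite mulrDr. Qed.

Lemma meanZ n c F : mean n (fun w => c * F w) = c * mean n F.
Proof. by rewrite /mean mulr_sumr; apply: eq_bigr => w _; rewrite mulrCA. Qed.

Lemma mean_cst n c : mean n (fun=> c) = c.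
Proof.
elim: n => [|n IH]; first by rewrite mean0.
by rewrite meanS; under eq_bigr do rewrite IH; rewrite -mulr_suml p1 mul1r.
Qed.

Lemma le_mean n F G : (forall w, F w <= G w) -> mean n F <= mean n G.
Proof. by move=> FG; apply: ler_sum => w _; rewrite ler_wpM2l // prodr_ge0. Qed.

(** Product weights do not see the order of the letters.  This exchanges the order of
the factors in a matrix product, which matters for the walk but not for its law. *)
Lemma mean_rev n F : mean n (fun w => F (rev w)) = mean n F.
Proof.
rewrite /mean [RHS](reindex_inj (h := fun w : n.-tuple L => rev_tuple w)) /=.
  by apply: eq_bigr => w _; congr (_ * _); apply: perm_big; rewrite perm_sym perm_rev.
by move=> w w' /(congr1 val) /= /(can_inj revK) H; apply/val_inj.
Qed.

Let eps a : R := (-1) ^+ e a.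
Let r := \sum_a p a * eps a.
Hypothesis r1 : `|r| < 1.
Let sw := word_walk e S.
Let mu := \sum_a p a * S a.
Let sigma2 := \sum_a p a * S a ^+ 2.
Let kappa := \sum_a p a * (S a * eps a).

(** The mean m_n of the walk satisfies m_(n+1) = mu + r m_n, where r is the mean sign. *)
Lemma mean_walk_le n : `|mean n sw| <= `|mu| / (1 - `|r|).
Proof.
have r1' : 0 < 1 - `|r| by rewrite subr_gt0.
elim: n => [|n IH]; first by rewrite mean0 normr0 divr_ge0 // ltW.
have -> : mean n.+1 sw = mu + r * mean n sw.
  rewrite meanS /mu /r mulr_suml -big_split; apply: eq_bigr => a _ /=.
  by rewrite meanD mean_cst meanZ mulrDr mulrA.
apply: (le_trans (ler_normD _ _)); rewrite normrM.
apply: (le_trans (lerD (lexx _) (ler_wpM2l (normr_ge0 r) IH))).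
rewrite le_eqVlt; apply/orP; left; apply/eqP; field.
by rewrite gt_eqF.
Qed.

(** The second moment v_n satisfies v_(n+1) = v_n + sigma2 + 2 kappa m_n with m_n
bounded, so it grows at most linearly. *)
Lemma mean_walk_sqr_le : exists2 K : R, 0 <= K & forall n, mean n (fun w => sw w ^+ 2) <= K * n%:R.
Proof.
pose M := `|mu| / (1 - `|r|).
have M0 : 0 <= M by rewrite divr_ge0 // subr_ge0 ltW.
exists (sigma2 + 2 * `|kappa| * M).
  apply: addr_ge0; last by rewrite mulr_ge0 // mulr_ge0.
  by apply: sumr_ge0 => a _; rewrite mulr_ge0 ?sqr_ge0.
elim=> [|n IH]; first by rewrite mean0 mulr0 expr0n.
have -> : mean n.+1 (fun w => sw w ^+ 2) =
  sigma2 + 2 * kappa * mean n sw + mean n (fun w => sw w ^+ 2).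
  have -> : mean n (fun w => sw w ^+ 2) = \sum_a p a * mean n (fun w => sw w ^+ 2).
    by rewrite -mulr_suml p1 mul1r.
  have step a : mean n (fun w => sw (a :: w) ^+ 2) =
    S a ^+ 2 + 2 * (S a * eps a) * mean n sw + mean n (fun w => sw w ^+ 2).
    rewrite -[S a ^+ 2](mean_cst n) -meanZ -!meanD.
    apply: eq_bigr => w _; congr (_ * _).
    by rewrite /= -/sw /eps; case: (e a); rewrite ?expr0 ?expr1; ring.
  rewrite meanS /sigma2 /kappa mulr_sumr mulr_suml -!big_split; apply: eq_bigr => a _ /=.
  by rewrite step; ring.
rewrite -(natr1 n) mulrDr mulr1 addrC lerD // lerD2l -mulrA -[leRHS]mulrA ler_pM2l //.
apply: (le_trans (ler_norm _)); rewrite normrM ler_wpM2l //; exact: mean_walk_le.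
Qed.

(** From the second moment by |S| <= (b S^2 + 1/b) / 2 with b = n^(-1/2). *)
Lemma mean_abs_walk_sublinear : n%:R^-1 * mean n (fun w => `|sw w|) @[n --> \oo] --> 0.
Proof.
have [K K0 HK] := mean_walk_sqr_le.
have H : (K + 1) / 2 * Num.sqrt (n%:R^-1) @[n --> \oo] --> 0.
  rewrite -[X in _ --> X](mulr0 ((K + 1) / 2)); apply: cvgMl_tmp.
  rewrite -[X in _ --> X]sqrtr0; apply: continuous_cvg; first exact: sqrt_continuous.
  by have := cvg_invn (1 : R); under eq_fun do rewrite mulr1.
apply: (squeeze_cvgr _ (cvg_cst 0) H).
near=> n.
have n0 : (0 < n)%N by near: n; exact: nbhs_infty_gt.
have nR : 0 < n%:R^-1 :> R by rewrite invr_gt0 ltr0n.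
apply/andP; split.
  apply: mulr_ge0; first exact: ltW.
  by apply: sumr_ge0 => w _; rewrite mulr_ge0 // prodr_ge0.
set b := Num.sqrt _.
have b0 : 0 < b by rewrite sqrtr_gt0.
have bb : b * b = n%:R^-1 by rewrite -expr2 sqr_sqrtr // ltW.
rewrite -bb -[leLHS]mulrA [leRHS]mulrC ler_pM2l //.
apply: (@le_trans _ _ (b * mean n (fun w => (b / 2) * sw w ^+ 2 + b^-1 / 2))).
  rewrite ler_pM2l //; apply: le_mean => w.
  rewrite -subr_ge0.
  rewrite -real_normK ?num_real //.
  have -> : b / 2 * `|sw w| ^+ 2 + b^-1 / 2 - `|sw w| = (b * `|sw w| - 1) ^+ 2 / (2 * b).
    by field; rewrite gt_eqF.
  by rewrite divr_ge0 ?sqr_ge0 // mulr_ge0 // ltW.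
rewrite meanD meanZ mean_cst mulrDr mulrA (mulrA b b) mulrA divff ?gt_eqF //.
rewrite mulrDl lerD ?mul1r // bb.
rewrite mulrAC [leRHS]mulrC [leRHS]mulrC ler_pM2r ?invr_gt0 //.
apply: (le_trans (ler_wpM2l (ltW nR) (HK n))).
by rewrite mulrCA mulVf ?mulr1 // pnatr_eq0 -lt0n.
Unshelve. all: by end_near. Qed.
End RandomWalk.

Section Lyapunov.
Variables (R : realType) (L : alphabetType) (p : L -> R)
  (rho : probability (seq_space L) R) (e : L -> bool) (S : L -> R) (c : R).
Hypotheses (Hrho : is_bernoulli p rho) (c0 : 0 < c)
  (r1 : `|\sum_a p a * (-1) ^+ e a| < 1).

(** Both singular values are treated at once, with g = 1 for the larger one and g = -1
for the smaller one: the logarithm is n ln c + g |S|, and |S| has sublinear mean. *)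
Lemma lyapunov_exponent_monomial_mx (alpha : 'M[R]_2 -> R) (g : R) :
  (forall e c S, 0 < c -> alpha (monomial_mx e c S) = c * expR (g * `|S|)) ->
  lyapunov_exponent alpha rho (fun a => monomial_mx (e a) c (S a)) = ln c.
Proof.
move=> Halpha; apply: cvg_lim => //.
have [p0 p1 _] := Hrho.
have E n : \int[rho]_x ln (alpha (word_matrix (fun a => monomial_mx (e a) c (S a)) (mkseq x n))) =
    n%:R * ln c + g * mean p n (fun w => `|word_walk e S w|).
  rewrite (bernoulli_integral _ (fun w => ln (alpha (word_matrix _ w))) Hrho).
  rewrite -[n%:R * ln c](mean_cst p1 n) -meanZ -meanD.
  rewrite -(mean_rev p n (fun w => _ + _)); apply: eq_bigr => w _; congr (_ * _).
  rewrite /word_matrix monomial_mx_prod Halpha ?exprn_gt0 // lnM ?posrE ?exprn_gt0 ?expR_gt0 //.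
  by rewrite expRK lnXn // size_rev size_tuple mulr_natl.
have H : ln c + g * (n%:R^-1 * mean p n (fun w => `|word_walk e S w|)) @[n --> \oo] --> ln c.
  rewrite -[X in _ --> X]addr0 -[X in _ + X](mulr0 g); apply: cvgD; first exact: cvg_cst.
  apply: cvgMl_tmp; exact: mean_abs_walk_sublinear.
apply: cvg_trans H; apply: near_eq_cvg; near=> n.
have n0 : (0 < n)%N by near: n; exact: nbhs_infty_gt.
rewrite E mulrDr (mulrA _ n%:R) mulVf ?mul1r ?(mulrCA g) //.
by rewrite pnatr_eq0 -lt0n.
Unshelve. all: by end_near. Qed.

Lemma lyapunov_max_monomial_mx :
  lyapunov_exponent (@singular_max R) rho (fun a => monomial_mx (e a) c (S a)) = ln c.
Proof. by apply: (lyapunov_exponent_monomial_mx (g := 1)) => *; rewrite mul1r singular_max_monomial_mx. Qed.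

Lemma lyapunov_min_monomial_mx :
  lyapunov_exponent (@singular_min R) rho (fun a => monomial_mx (e a) c (S a)) = ln c.
Proof. by apply: (lyapunov_exponent_monomial_mx (g := -1)) => *; rewrite mulN1r singular_min_monomial_mx. Qed.

(** With equal exponents l, the three cases h/(-l), 1 + (h + l)/(-l) and 2h/(-2l) agree. *)
Lemma lyapunov_dimension_monomial_mx : c < 1 ->
  lyapunov_dimension rho (fun a => monomial_mx (e a) c (S a)) =
  fine (metric_entropy rho (@Defs.shift L)) / - ln c.
Proof.
move=> c1; rewrite /lyapunov_dimension lyapunov_max_monomial_mx lyapunov_min_monomial_mx /=.
have l0 : ln c < 0 by rewrite ln_lt0 ?c0.
by case: ltP => // _; case: ltP => _; field; lra.
Qed.
End Lyapunov.

Section Parity.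
Variables (R : realType) (L : finType) (p : L -> R) (e : L -> bool).
Hypotheses (p0 : forall a, 0 < p a) (p1 : \sum_a p a = 1).
(** The mean sign is a proper convex combination of 1 and -1. *)
Lemma mean_sign_lt1 a b : ~~ e a -> e b -> `|\sum_a p a * (-1) ^+ e a| < 1.
Proof.
move=> /negbTE ea eb.
have pos (F : L -> R) i : (forall j, 0 <= F j) -> 0 < F i -> 0 < \sum_j F j.
  by move=> F0 Fi; rewrite (bigD1 i) //= ltr_wpDr // sumr_ge0.
have H1 : 0 < \sum_i p i * (1 - (-1) ^+ e i).
  apply: (pos (fun i => p i * (1 - (-1) ^+ e i)) b) => [i|]; last by rewrite eb expr1 mulr_gt0 //; lra.
  by rewrite mulr_ge0 ?(ltW (p0 i)) //; case: (e i); rewrite ?expr0 ?expr1; lra.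
have H2 : 0 < \sum_i p i * (1 + (-1) ^+ e i).
  apply: (pos (fun i => p i * (1 + (-1) ^+ e i)) a) => [i|]; last by rewrite ea expr0 mulr_gt0 //; lra.
  by rewrite mulr_ge0 ?(ltW (p0 i)) //; case: (e i); rewrite ?expr0 ?expr1; lra.
move: H1 H2; under eq_bigr do rewrite mulrBr mulr1.
under [X in _ -> 0 < X -> _]eq_bigr do rewrite mulrDr mulr1.
rewrite sumrB big_split /= p1 ltr_norml => H1 H2; apply/andP; split; lra.
Qed.
End Parity.

(** * Clopen sets and invariance of Bernoulli measures *)

(** The clopen sets of the product topology: those determined by N coordinates.  They
form an algebra that generates the measurable sets. *)
Definition clopen (L : alphabetType) N (P : pred (seq L)) : set (seq_space L) :=
  [set x | P (mkseq x N)].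

Section Shift.
Variables (R : realType) (L : alphabetType).

Lemma measurable_clopen N (P : pred (seq L)) : measurable (clopen N P).
Proof. exact: (measurable_fin_preimage (fun w : N.-tuple L => P w) (@measurable_prefix_tuple L N)). Qed.

Lemma clopen_widen N N' (P : pred (seq L)) : (N <= N')%N ->
  clopen N P = clopen N' (fun w => P (take N w)).
Proof.
move=> NN'; rewrite /clopen; congr mkset; apply/funext => x.
by rewrite /mkseq -map_take take_iota (minn_idPl NN').
Qed.

Lemma clopen_coord k (a : L) :
  [set x : nat -> L | x k = a] = clopen k.+1 (fun w => nth point w k == a).
Proof.
by apply/seteqP; split => x /=; rewrite /clopen /= nth_mkseq // => /eqP.
Qed.

Lemma clopenI : setI_closed [set A | exists N P, A = @clopen L N P].
Proof.
move=> _ _ [N [P ->]] [M [Q ->]].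
rewrite (clopen_widen P (leq_maxl N M)) (clopen_widen Q (leq_maxr N M)).
exists (maxn N M), (fun w => P (take N w) && Q (take M w)).
by apply/seteqP; split => x; rewrite /clopen /= => /andP.
Qed.

Lemma measurable_clopenE :
  @measurable _ (seq_space L) = <<s [set A | exists N P, A = @clopen L N P] >>.
Proof.
apply/seteqP; split.
  apply: sub_smallest2r; first exact: smallest_sigma_algebra.
  by move=> _ [k [a ->]]; rewrite clopen_coord; exists k.+1; eexists.
apply: smallest_sub; first exact: sigma_algebra_measurable.
by move=> _ [N [P ->]]; exact: measurable_clopen.
Qed.

Lemma shift_clopen N (P : pred (seq L)) :
  @Defs.shift L @^-1` clopen N P = clopen N.+1 (fun w => P (behead w)).
Proof.
rewrite /clopen; apply/seteqP; split => x /=; rewrite /mkseq /= -[1%N]add1n iotaDl -map_comp //.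
Qed.

Lemma measurable_shift : measurable_fun setT (@Defs.shift L : seq_space L -> seq_space L).
Proof.
apply: (@measurability _ _ (seq_space L) (seq_space L) setT (@Defs.shift L) _ measurable_clopenE).
by move=> _ [_ [N [P ->]] <-]; rewrite setTI shift_clopen; exact: measurable_clopen.
Qed.

Lemma bernoulli_clopen (p : L -> R) (rho : probability (seq_space L) R) N P :
  is_bernoulli p rho -> rho (clopen N P) = (mean p N (fun w => (P w)%:R))%:E.
Proof.
move=> H; rewrite -[LHS]fineK ?fin_num_measure //; last exact: measurable_clopen.
congr EFin; have [_ _ Hcyl] := H.
rewrite (fine_measure_fin_preimage rho (fun w : N.-tuple L => P w) (@measurable_prefix_tuple L N)).
by apply: eq_bigr => w _; rewrite prefix_tuple_fiber Hcyl /= mulrC.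
Qed.

(** Invariance holds on clopen sets, where it says that the weights of the first letter
sum to 1, and extends by the pi-lambda theorem. *)
Lemma bernoulli_shift (p : L -> R) (rho : probability (seq_space L) R) (A : set (seq_space L)) :
  is_bernoulli p rho -> measurable A -> rho (@Defs.shift L @^-1` A) = rho A.
Proof.
move=> H; have [p0 p1 _] := H.
have mS (B : set (seq_space L)) : measurable B -> measurable (@Defs.shift L @^-1` B : set (seq_space L)).
  by move=> mB; rewrite -[X in measurable X]setTI; apply: measurable_shift.
move=> mA; move: (mA); rewrite measurable_clopenE; move: A {mA}.
apply: (dynkin_induction measurable_clopenE clopenI).
- by rewrite preimage_setT.
- move=> _ [N [P ->]]; rewrite shift_clopen !(bernoulli_clopen _ _ H) meanS.
  by rewrite /= -mulr_suml p1 mul1r.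
- move=> B mB HB; rewrite preimage_setC !probability_setC ?HB //; exact: mS.
- move=> F mF tF HF; rewrite preimage_bigcup !measure_bigcup //=.
  + by apply: eq_eseriesr => i _; exact: HF.
  + by move=> i _; apply: mS.
  + apply/trivIsetP => i j _ _ ij; rewrite -preimage_setI.
    by move/trivIsetP : tF => /(_ i j Logic.I Logic.I ij) ->; rewrite preimage_set0.
Qed.
End Shift.

(** * Approximation of measurable sets and functions by clopen ones *)

Local Notation symdiff A B := ((A `\` B) `|` (B `\` A)).

Section Approx.
Variables (R : realType) (L : alphabetType) (rho : probability (seq_space L) R).

(** The distance between A and B is the measure of their symmetric difference. *)
Definition approximable : set (set (seq_space L)) :=
  [set A | measurable A /\ forall d : R, 0 < d ->
    exists N P, (rho (symdiff A (clopen N P)) <= d%:E)%E].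

Lemma measurable_symdiff (A B : set (seq_space L)) :
  measurable A -> measurable B -> measurable (symdiff A B).
Proof. by move=> mA mB; apply: measurableU; apply: measurableD. Qed.

Lemma approximable_clopen N P : approximable (clopen N P).
Proof.
split; first exact: measurable_clopen.
by move=> d d0; exists N, P; rewrite setDv setU0 measure0 lee_fin ltW.
Qed.

Lemma approximableC A : approximable A -> approximable (~` A).
Proof.
move=> [mA HA]; split; first exact: measurableC.
move=> d d0; have [N [P H]] := HA d d0; exists N, (fun w => ~~ P w).
apply: le_trans H; rewrite le_eqVlt; apply/orP; left; apply/eqP; congr (rho _).
have -> : clopen N (fun w => ~~ P w) = ~` clopen N P.
  by apply/seteqP; split => x /negP.
by rewrite !setDE !setCK setUC; congr setU; exact: setIC.
Qed.

Lemma approximableU A B : approximable A -> approximable B -> approximable (A `|` B).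
Proof.
move=> [mA HA] [mB HB]; split; first exact: measurableU.
move=> d d0; have d20 : 0 < d / 2 by rewrite divr_gt0.
have [N [P HP]] := HA _ d20; have [M [Q HQ]] := HB _ d20.
exists (maxn N M), (fun w => P (take N w) || Q (take M w)).
rewrite (splitr d) EFinD; apply: le_trans (leeD HP HQ).
have mP := measurable_symdiff mA (measurable_clopen N P).
have mQ := measurable_symdiff mB (measurable_clopen M Q).
apply: le_trans (measureU2 _ mP mQ).
apply: le_measure; rewrite ?inE; [|exact: measurableU|].
  by apply: measurable_symdiff; [exact: measurableU|exact: measurable_clopen].
rewrite (clopen_widen P (leq_maxl N M)) (clopen_widen Q (leq_maxr N M)).
move=> x; rewrite /clopen /=.
rewrite (_ : is_true (_ || _) = (P (take N (mkseq x (maxn N M))) \/ Q (take M (mkseq x (maxn N M))))).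
  tauto.
by apply/propext; split => /orP.
Qed.

(** The union is approximated by a finite subunion, by continuity from below. *)
Lemma approximable_bigcup (F : nat -> set (seq_space L)) :
  (forall k, approximable (F k)) -> approximable (\bigcup_k F k).
Proof.
move=> HF; have mF k : measurable (F k) by have [] := HF k.
have mU : measurable (\bigcup_k F k) by exact: bigcup_measurable.
split=> // d d0; have d20 : 0 < d / 2 by rewrite divr_gt0.
pose U K := \big[setU/set0]_(k < K) F k.
have HU K : approximable (U K).
  elim: K => [|K IH]; last by rewrite /U big_ord_recr; exact: approximableU.
  rewrite /U big_ord0 (_ : set0 = clopen 0 pred0); first exact: approximable_clopen.
  by apply/seteqP; split.
have UE : \bigcup_K U K = \bigcup_k F k.
  apply/seteqP; split=> [x [K _]|x [k _ Fx]].
    by rewrite /U -bigcup_mkord => -[k _ Fx]; exists k.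
  by exists k.+1 => //; rewrite /U -bigcup_mkord; exists k => /=.
have mUK K : measurable (U K) by have [] := HU K.
have : rho \o U @ \oo --> rho (\bigcup_K U K).
  apply: nondecreasing_cvg_mu => //; first by rewrite UE.
  by move=> K K' KK'; apply/subsetPset; exact: subset_bigsetU.
rewrite UE -[X in _ --> X]fineK ?fin_num_measure // => /fine_cvgP [_].
move=> /cvgrPdist_lt /(_ _ d20) [K _ /(_ K (leqnn K))] /= HK.
have [_ /(_ _ d20) [N [P HP]]] := HU K; exists N, P.
have USub : U K `<=` \bigcup_k F k by rewrite -UE => x ?; exists K.
have mP := measurable_clopen N P.
rewrite (splitr d) EFinD.
apply: (@le_trans _ _ (rho ((\bigcup_k F k) `\` U K) + rho (symdiff (U K) (clopen N P)))%E).
  apply: le_trans (measureU2 _ _ _); [|exact: measurableD|exact: measurable_symdiff].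
  apply: le_measure; rewrite ?inE; [exact: measurable_symdiff| |].
    by apply: measurableU; [exact: measurableD|exact: measurable_symdiff].
  move=> x /=; have := USub x; case: (pselect (U K x)); tauto.
apply: leeD HP.
rewrite measureD //; last by rewrite ltey_eq fin_num_measure.
rewrite (setIidr USub).
have : ((fine (rho (\bigcup_k F k)))%:E - (fine (rho (U K)))%:E <= (d / 2)%:E)%E.
  by rewrite -EFinB lee_fin ltW //; exact: le_lt_trans (ler_norm _) HK.
by rewrite !fineK ?fin_num_measure.
Qed.

Lemma approximable_measurable (A : set (seq_space L)) : measurable A -> approximable A.
Proof.
apply: smallest_sub.
  split.
  - rewrite (_ : set0 = clopen 0 pred0); first exact: approximable_clopen.
    by apply/seteqP; split.
  - by move=> B HB; rewrite setTD; exact: approximableC.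
  - exact: approximable_bigcup.
by move=> _ [k [a ->]]; rewrite clopen_coord; exact: approximable_clopen.
Qed.

(** Each fibre of f is approximated by a clopen set, and g sends a word to a label whose
clopen set contains it.  Where f and g differ, some fibre differs from its clopen
approximation. *)
Lemma approximable_fun k (f : seq_space L -> 'I_k) (d : R) :
  (forall j, measurable (f @^-1` [set j])) -> 0 < d ->
  exists N (g : seq L -> 'I_k),
    (rho [set x | f x != g (mkseq x N)] <= d%:E)%E.
Proof.
move=> mf d0.
have k0 : (0 < k)%N by case: (f point) => m; exact: leq_ltn_trans.
have dk0 : 0 < d / k%:R by rewrite divr_gt0 // ltr0n.
have /choice [N /choice [P HP]] : forall j, exists N, exists P,
  (rho (symdiff (f @^-1` [set j]) (clopen N P)) <= (d / k%:R)%:E)%E.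
  by move=> j; have [_ /(_ _ dk0)] := approximable_measurable (mf j).
pose M := (\max_j N j)%N.
exists M, (fun w => odflt (f point) [pick j | P j (take (N j) w)]).
pose D j := symdiff (f @^-1` [set j]) (clopen (N j) (P j)).
have mD j : measurable (D j) := measurable_symdiff (mf j) (measurable_clopen (N j) (P j)).
have sub : [set x | f x != odflt (f point) [pick j | P j (take (N j) (mkseq x M))]]
    `<=` \big[setU/set0]_(j < k) D j.
  move=> x /= /eqP Hx; apply: contrapT => nD; apply: Hx.
  have HD j : (f x == j) = P j (take (N j) (mkseq x M)).
    have NM : (N j <= M)%N by rewrite /M (bigmaxD1 j) // leq_max leqnn.
    have : ~ D j x by move=> Dx; apply: nD; rewrite (bigD1 j) //=; left.
    rewrite /D (clopen_widen (P j) NM) /clopen /=.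
    move=> nDj; apply/idP/idP => [/eqP fj|Pj]; apply: contrapT => H; apply: nDj.
      by left.
    by right; split => // /eqP.
  case: pickP => [j|/(_ (f x))] /=; rewrite -HD; first by move/eqP.
  by rewrite eqxx.
have mB : measurable (\big[setU/set0]_(j < k) D j) by apply: bigsetU_measurable.
apply: (@le_trans _ _ (rho (\big[setU/set0]_(j < k) D j))).
  apply: le_measure; rewrite ?inE //.
  exact: (measurable_fin_preimage
    (fun u : 'I_k * M.-tuple L => u.1 != odflt (f point) [pick j | P j (take (N j) u.2)])
    (measurable_pair_fiber mf (@measurable_prefix_tuple L M))).
have [_ HB] : measurable (\big[setU/set0]_(j < k) D j) /\
    (rho (\big[setU/set0]_(j < k) D j) <= (\sum_(j < k) d / k%:R)%:E)%E.
  apply: (big_ind2 (fun A r => measurable A /\ (rho A <= r%:E)%E)).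
  - by rewrite measure0.
  - move=> A r B r' [mA Ar] [mB' Br]; split; first exact: measurableU.
    by rewrite EFinD; apply: le_trans (measureU2 _ mA mB') (leeD Ar Br).
  - by move=> j _; split; [exact: mD|exact: HP].
apply: le_trans HB _; rewrite lee_fin sumr_const card_ord -[leLHS]mulr_natr divfK //.
by rewrite pnatr_eq0 -lt0n.
Qed.
End Approx.

(** * The metric entropy of the shift is at most the logarithm of the alphabet size *)

(** From 1 + ln t <= t applied to t = q i / p i. *)
Lemma gibbs_inequality (R : realType) (I : finType) (p q : I -> R) :
  (forall i, 0 <= p i) -> \sum_i p i = 1 -> (forall i, 0 < q i) -> \sum_i q i <= 1 ->
  \sum_i - (p i * ln (p i)) <= \sum_i - ln (q i) * p i.
Proof.
move=> p0 p1 q0 q1.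
apply: (@le_trans _ _ (\sum_i (- ln (q i) * p i + (q i - p i)))).
  apply: ler_sum => i _.
  have := p0 i; rewrite le_eqVlt => /orP[/eqP <-|pi0].
    by rewrite mul0r mulr0 oppr0 add0r addr0 ltW.
  have : 1 + ln (q i / p i) <= q i / p i.
    by rewrite -[leRHS]lnK ?expR_ge1Dx // posrE divr_gt0.
  rewrite ler_pdivlMr // ln_div ?posrE //; lra.
rewrite big_split /= gerDl sumrB p1; lra.
Qed.

Lemma big_tuple_distr (R : realType) (J : finType) n (F : 'I_n -> J -> R) :
  \sum_(w : n.-tuple J) \prod_(i < n) F i (tnth w i) = \prod_(i < n) \sum_j F i j.
Proof.
rewrite bigA_distr_bigA /=.
rewrite (reindex (fun f : {ffun 'I_n -> J} => [tuple f i | i < n])) /=.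
  by apply: eq_bigr => f _; apply: eq_bigr => i _; rewrite tnth_mktuple.
exists (fun w : n.-tuple J => [ffun i => tnth w i]) => [f _|w _].
  by apply/ffunP => i; rewrite ffunE tnth_mktuple.
by apply: eq_from_tnth => i; rewrite tnth_mktuple ffunE.
Qed.

Section Entropy.
Variables (R : realType) (L : alphabetType) (rho : probability (seq_space L) R).
Let T : seq_space L -> seq_space L := @Defs.shift L.
Hypothesis inv : forall A : set (seq_space L), measurable A -> rho (T @^-1` A) = rho A.

Lemma measurable_iter_preimage i (A : set (seq_space L)) :
  measurable A -> measurable (iter i T @^-1` A).
Proof.
elim: i A => [|i IH] A mA //.
rewrite (_ : _ @^-1` A = iter i T @^-1` (T @^-1` A)) //; apply: IH.
by rewrite -[X in measurable X]setTI; apply: measurable_shift.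
Qed.

Lemma iter_invariant i (A : set (seq_space L)) :
  measurable A -> rho (iter i T @^-1` A) = rho A.
Proof.
elim: i A => [|i IH] A mA //.
rewrite (_ : _ @^-1` A = iter i T @^-1` (T @^-1` A)) // IH ?inv //.
exact: (@measurable_iter_preimage 1).
Qed.

Lemma iter_shiftE i j (x : seq_space L) : iter i T x j = x (i + j)%N.
Proof. by elim: i j => // i IH j; rewrite iterS /T /Defs.shift IH addnS. Qed.

Variables (k : nat) (f : seq_space L -> 'I_k).
Hypothesis mf : forall j, measurable (f @^-1` [set j]).

Definition itinerary n (x : seq_space L) : n.-tuple 'I_k := [tuple f (iter i T x) | i < n].

Lemma itinerary_fiber n (w : n.-tuple 'I_k) :
  itinerary n @^-1` [set w] = [set x | forall i : 'I_n, f (iter i T x) = tnth w i].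
Proof.
apply/seteqP; split => x /=; first by move=> <- i; rewrite tnth_mktuple.
by move=> H; apply: eq_from_tnth => i; rewrite tnth_mktuple.
Qed.

Lemma measurable_itinerary n (w : n.-tuple 'I_k) : measurable (itinerary n @^-1` [set w]).
Proof.
rewrite itinerary_fiber (_ : [set _ | _] =
  \bigcap_(i in [set: 'I_n]) (iter i T @^-1` (f @^-1` [set tnth w i]))).
  by apply: fin_bigcap_measurable => // i _; apply: measurable_iter_preimage.
by apply/seteqP; split => x /= H i; [move=> _|]; apply: H.
Qed.

(** A word u of n + N letters predicts the itinerary (g (u_i ... u_(i+N-1)))_(i < n).
The weight q w of an itinerary w is, up to normalisation, the sum over all u of
e^(-b err), where err counts the errors of the prediction.  The normalisation Z
makes q a subprobability, and a single u already bounds q w from below; hence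
- ln (q w) <= ln Z + b err for every u, in particular for the word formed by the
first n + N letters of the point under consideration. *)
Section Coding.
Variables (N : nat) (g : seq L -> 'I_k) (b d : R).
Hypothesis b0 : 0 <= b.
Hypothesis fg : (rho [set x | f x != g (mkseq x N)] <= d%:E)%E.

Let gi (u : seq L) i := g (mkseq (fun j => nth point u (i + j)) N).
Let err n (w : n.-tuple 'I_k) (u : seq L) : R := \sum_(i < n) (tnth w i != gi u i)%:R.
Let Z n : R := (#|L| ^ (n + N))%:R * (1 + k%:R * expR (- b)) ^+ n.
Let q n (w : n.-tuple 'I_k) : R :=
  (Z n)^-1 * \sum_(u : (n + N).-tuple L) expR (- (b * err w u)).

Let cardL0 : (0 < #|L|)%N.
Proof. by apply/card_gt0P; exists point. Qed.

Let Z_gt0 n : 0 < Z n.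
Proof.
by rewrite mulr_gt0 ?ltr0n ?expn_gt0 ?cardL0 // exprn_gt0 // ltr_wpDr // mulr_ge0 // expR_ge0.
Qed.

(** For fixed u the sum over w factorises into n sums, each with one correct label of
weight 1 and k - 1 wrong ones of weight e^(-b). *)
Lemma coding_weight_sum n : \sum_w q (n:=n) w <= 1.
Proof.
rewrite -mulr_sumr ler_pdivrMl // mulr1 exchange_big /=.
apply: (@le_trans _ _ (\sum_(u : (n + N).-tuple L) (1 + k%:R * expR (- b)) ^+ n)); last first.
  by rewrite sumr_const card_tuple -[leLHS]mulr_natl.
apply: ler_sum => u _.
have E (w : n.-tuple 'I_k) : expR (- (b * err w u)) =
    \prod_(i < n) expR (- (b * (tnth w i != gi u i)%:R)).
  by rewrite -expR_sum /err mulr_sumr sumrN.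
under eq_bigr do rewrite E.
rewrite (big_tuple_distr (fun i j => expR (- (b * (j != gi u i)%:R)))).
rewrite -[n in leRHS]card_ord -prodr_const; apply: ler_prod => i _.
rewrite sumr_ge0 => [/=|j _]; last exact: expR_ge0.
rewrite (bigD1 (gi u i)) //= eqxx mulr0 oppr0 expR0 lerD2l.
apply: (@le_trans _ _ (\sum_(j | j != gi u i) expR (- b))).
  by apply: ler_sum => j ->; rewrite mulr1.
rewrite -[k in leRHS]card_ord mulr_natl -sumr_const big_mkcond /=.
by apply: ler_sum => j _; case: ifP => _ //; exact: expR_ge0.
Qed.

Lemma coding_length_le n (w : n.-tuple 'I_k) (u : (n + N).-tuple L) :
  - ln (q w) <= ln (Z n) + b * err w u.
Proof.
rewrite lerNl opprD -lnV ?posrE // -[- (b * _)]expRK -lnM ?posrE ?invr_gt0 ?expR_gt0 //.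
have H : (Z n)^-1 * expR (- (b * err w u)) <= q w.
  rewrite ler_pM2l ?invr_gt0 // (bigD1 u) //= lerDl sumr_ge0 // => *; exact: expR_ge0.
by rewrite ler_ln ?posrE //; [|apply: lt_le_trans H]; rewrite mulr_gt0 ?invr_gt0 ?expR_gt0.
Qed.

Lemma coding_weight_gt0 n (w : n.-tuple 'I_k) : 0 < q w.
Proof.
rewrite mulr_gt0 ?invr_gt0 //.
rewrite (bigD1 (prefix_tuple (n + N) point)) //= ltr_wpDr ?expR_gt0 // sumr_ge0 // => *; exact: expR_ge0.
Qed.

Lemma ln_normalisation_le n : ln (Z n) <= (n + N)%:R * ln #|L|%:R + n%:R * (k%:R * expR (- b)).
Proof.
have K0 : 0 < 1 + k%:R * expR (- b) by rewrite ltr_wpDr // mulr_ge0 // expR_ge0.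
rewrite /Z natrX lnM ?posrE ?exprn_gt0 ?ltr0n // !lnXn ?ltr0n //.
rewrite -!(mulr_natl (ln _)) lerD2l ler_wpM2l //.
by rewrite -ler_expR lnK ?posrE // expR_ge1Dx.
Qed.

(** Averaging the description length of the itinerary given the true prefix: by
invariance each of the n predictions fails with probability at most d. *)
Lemma join_entropy_le n : join_entropy rho T f n <=
  (n + N)%:R * ln #|L|%:R + n%:R * (k%:R * expR (- b)) + b * (n%:R * d).
Proof.
pose P (w : n.-tuple 'I_k) : R := fine (rho (itinerary n @^-1` [set w])).
have -> : join_entropy rho T f n = \sum_w - (P w * ln (P w)).
  by apply: eq_bigr => w _; rewrite /P itinerary_fiber.
have P1 : \sum_w P w = 1.
  have := fine_measure_fin_preimage rho predT (@measurable_itinerary n).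
  rewrite (_ : [set x | _] = setT) ?probability_setT; last by apply/seteqP.
  by move=> /= ->; apply: eq_bigr => w _; rewrite mul1r.
have P0 w : 0 <= P w by rewrite fine_ge0.
apply: (le_trans (gibbs_inequality P0 P1 (@coding_weight_gt0 n) (coding_weight_sum n))).
have mh := measurable_pair_fiber (@measurable_itinerary n) (@measurable_prefix_tuple L (n + N)).
rewrite -(Rintegral_fin rho (fun w => - ln (q w)) (@measurable_itinerary n)).
rewrite (Rintegral_fin rho (fun v => - ln (q v.1)) mh).
pose ph (v : n.-tuple 'I_k * (n + N).-tuple L) :=
  fine (rho ((fun x => (itinerary n x, prefix_tuple (n + N) x)) @^-1` [set v])).
have ph0 v : 0 <= ph v by rewrite fine_ge0.
have ph1 : \sum_v ph v = 1.
  have := fine_measure_fin_preimage rho predT mh.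
  rewrite (_ : [set x | _] = setT) ?probability_setT; last by apply/seteqP.
  by move=> /= ->; apply: eq_bigr => w _; rewrite mul1r.
apply: (@le_trans _ _ (\sum_(v : n.-tuple 'I_k * (n + N).-tuple L) (ln (Z n) + b * err v.1 v.2) * ph v)).
  by apply: ler_sum => v _; apply: ler_wpM2r; [exact: ph0|exact: coding_length_le].
under eq_bigr do rewrite mulrDl -mulrA.
rewrite big_split /= -!mulr_sumr ph1 mulr1 lerD ?ln_normalisation_le // ler_wpM2l //.
under eq_bigr do rewrite /err mulr_suml.
rewrite exchange_big /= -[n in n%:R]card_ord mulr_natl -sumr_const; apply: ler_sum => i _.
pose Q (v : n.-tuple 'I_k * (n + N).-tuple L) := tnth v.1 i != gi v.2 i.
rewrite -(fine_measure_fin_preimage rho Q mh) -lee_fin fineK ?fin_num_measure //;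
  last exact: (measurable_fin_preimage Q mh).
apply: le_trans fg; rewrite -[leRHS](iter_invariant i); last first.
  exact: (measurable_fin_preimage
    (fun u : 'I_k * N.-tuple L => u.1 != g u.2) (measurable_pair_fiber mf (@measurable_prefix_tuple L N))).
rewrite le_eqVlt; apply/orP; left; apply/eqP; congr (rho _).
have E x : gi (prefix_tuple (n + N) x) i = g (mkseq (iter i T x) N).
  rewrite /gi; congr g; apply/eq_in_map => j; rewrite mem_iota => /andP[_ jN].
  rewrite nth_mkseq ?iter_shiftE //.
  by apply: (@leq_ltn_trans (n + j)); rewrite ?leq_add2r ?ltn_add2l // ltnW.
by apply/seteqP; split => x; rewrite /Q /= tnth_mktuple E.
Qed.
End Coding.

(** The two error terms k e^(-b) and b d are made small by the choice of b and then of
d, while the N additional letters disappear in the limit.  When the sequence diverges,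
its conventional limit is 0, which is also below the bound. *)
Lemma partition_entropy_le : partition_entropy rho T f <= ln #|L|%:R.
Proof.
have k0 : (0 < k)%N by case: (f point) => m; exact: leq_ltn_trans.
have L0 : 0 <= ln #|L|%:R :> R.
  by rewrite ln_ge0 // ler1n; apply/card_gt0P; exists point.
rewrite /partition_entropy.
have [ucv|/dvgP ->] := pselect (cvgn (fun n : nat => n%:R^-1 * join_entropy rho T f n));
  last exact: L0.
apply/ler_addgt0Pr => eta eta0.
(* k e^(-b) <= k / b = eta / 2 *)
pose b := 2 * k%:R / eta.
have b0 : 0 < b by rewrite divr_gt0 // mulr_gt0 // ltr0n.
have kb : k%:R * expR (- b) <= eta / 2.
  rewrite expRN ler_pdivrMr ?expR_gt0 //.
  have -> : k%:R = eta / 2 * b by rewrite /b; field; rewrite gt_eqF.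
  rewrite ler_pM2l ?divr_gt0 //; apply: le_trans (expR_ge1Dx b); lra.
have d0 : 0 < eta / 2 / b by rewrite divr_gt0 // divr_gt0.
have [N [g fg]] := approximable_fun rho mf d0.
have cv : n%:R^-1 * (N%:R * ln #|L|%:R) + (ln #|L|%:R + eta) @[n --> \oo] --> ln #|L|%:R + eta.
  by rewrite -[X in _ --> X]add0r; apply: cvgD; [exact: cvg_invn|exact: cvg_cst].
rewrite -(cvg_lim (@Rhausdorff R) cv); apply: ler_lim => //; first by apply/cvg_ex; eexists; exact: cv.
near=> n.
have n0 : (0 < n)%N by near: n; exact: nbhs_infty_gt.
have nR : 0 < n%:R :> R by rewrite ltr0n.
rewrite ler_pdivrMl //; apply: le_trans (join_entropy_le (ltW b0) fg n) _.
rewrite natrD [leRHS]mulrDr mulVKf ?gt_eqF //.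
have -> : b * (n%:R * (eta / 2 / b)) = n%:R * (eta / 2) by field; rewrite gt_eqF.
have := ler_wpM2l (ltW nR) kb; lra.
Unshelve. all: by end_near. Qed.
End Entropy.

Lemma metric_entropy_le (R : realType) (L : alphabetType) (rho : probability (seq_space L) R) :
  (forall A : set (seq_space L), measurable A -> rho (@Defs.shift L @^-1` A) = rho A) ->
  fine (metric_entropy rho (@Defs.shift L)) <= ln #|L|%:R.
Proof.
move=> inv.
have L0 : 0 <= ln #|L|%:R :> R.
  by rewrite ln_ge0 // ler1n; apply/card_gt0P; exists point.
have : (metric_entropy rho (@Defs.shift L) <= (ln #|L|%:R)%:E)%E.
  apply: ge_ereal_sup => _ [k [f [mf ->]]]; rewrite lee_fin.
  exact: partition_entropy_le.
by case: metric_entropy => //= r; rewrite lee_fin.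
Qed.

(** * The Lyapunov dimension of Bernoulli measures on blocks *)

(** A block of length n is again a monomial matrix, with c = (2/5)^n, and the alphabet of
blocks has 2^n letters.  The block without swap and a block with exactly one swap
have opposite parities, and both have positive probability. *)
Lemma lyapunov_dimension_blocks (R : realType) (n : nat)
  (nu : probability (seq_space (n.-tuple 'I_2)) R) :
  (1 <= n)%N -> fully_supported_bernoulli nu ->
  lyapunov_dimension nu (fun i : n.-tuple 'I_2 => word_matrix (example_mx R) i) <= ln 2 / ln (5 / 2).
Proof.
move=> n1 [p Hp p0]; have [_ p1 _] := Hp.
have l0 : 0 < ln (5 / 2 : R) by rewrite ln_gt0 //; lra.
have lc : ln ((2 / 5 : R) ^+ n) = - (n%:R * ln (5 / 2)).
  by rewrite lnXn ?divr_gt0 // -[_ *+ n]mulr_natl -mulrN -lnV ?posrE ?divr_gt0 // invf_div.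
have n0 : 0 < n%:R :> R by rewrite ltr0n.
pose e (i : n.-tuple 'I_2) := word_parity (fun j : 'I_2 => j == 1) i.
have -> : (fun i : n.-tuple 'I_2 => word_matrix (example_mx R) i) =
  fun i => monomial_mx (e i) ((2 / 5) ^+ n)
    (word_walk (fun j : 'I_2 => j == 1) (fun j : 'I_2 => if j == 1 then 0 else ln 2) (rev i)).
  by apply/funext => i; rewrite /word_matrix example_mx_prod size_rev size_tuple word_parity_rev.
rewrite (lyapunov_dimension_monomial_mx _ Hp).
- rewrite lc opprK ler_pdivrMr ?mulr_gt0 //.
  have := @metric_entropy_le _ _ nu (fun A => bernoulli_shift Hp).
  rewrite card_tuple card_ord natrX lnXn // -[ln 2 *+ n]mulr_natl => H.
  by apply: le_trans H _; rewrite mulrCA divfK ?gt_eqF.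
- by rewrite exprn_gt0 // divr_gt0.
- case: n n1 {nu Hp lc n0} p p0 p1 @e => // n _ p p0 p1 e.
  apply: (mean_sign_lt1 p0 p1 (a := nseq_tuple n.+1 0) (b := cons_tuple 1 (nseq_tuple n 0))).
    rewrite /e /word_parity big1_seq //= => j; rewrite inE mem_nseq.
    by move=> /orP[/eqP ->|/andP[_ /eqP ->]].
  rewrite /e /word_parity big_cons big1_seq //= => j; rewrite mem_nseq.
  by move=> /andP[_ /eqP ->].
- by rewrite exprn_ilt1 // -?lt0n //; lra.
Qed.

Theorem mainTheorem5 (R : realType) :
  exists (m : nat) (A : 'I_m.+2 -> 'M[R]_2),
    [/\ forall i, A i \in unitmx,
        forall i, operator_norm (A i) < 1 &
        (ereal_sup [set d : \bar R |
           exists (n : nat) (nu : probability (seq_space (n.-tuple 'I_m.+2)) R),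
             [/\ (1 <= n)%N, fully_supported_bernoulli nu &
                 d = (lyapunov_dimension nu
                        (fun i : n.-tuple 'I_m.+2 => word_matrix A i))%:E]]
         < (affinity_dimension A)%:E)%E].
Proof.
exists 0, (example_mx R); split; [exact: example_mx_unit|exact: operator_norm_example_mx|].
apply: (@le_lt_trans _ _ (ln 2 / ln (5 / 2))%:E).
  by apply: ge_ereal_sup => _ [n [nu [n1 Hnu ->]]]; rewrite lee_fin lyapunov_dimension_blocks.
rewrite lte_fin; apply: lt_le_trans (affinity_dimension_example_mx_ge1 R).
have l0 : 0 < ln (5 / 2 : R) by rewrite ln_gt0 //; lra.
by rewrite ltr_pdivrMr // mul1r ltr_ln ?posrE //; lra.
Qed.
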